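(* Fix $1<p<\infty$ and let $q$ be defined by $1/p+1/q=1$. Let $G$ be a commutative group, $U\subset G$ a $d$-dimensional quasicube and $V\subset U$. Then \[ \beta_p(V)\ge c_p^d\,|V|,\qquad\text{where } c_p=\frac{p^{1/p}q^{1/q}}{2}\le 1. \]
   Context: All groups are commutative and written additively. For a finite $U\subset G$ and $1<p<\infty$, $\beta_p(U)=\inf_{A,B}\frac{|A+B+U|}{|A|^{1/p}|B|^{1-1/p}}$, the infimum over all nonempty finite $A,B\subset G$. Quasicubes are defined recursively: a $0$-dimensional quasicube is any singleton; a finite set $U\subset G$ is a $d$-dimensional quasicube ($d\ge1$) if there is a proper subgroup $G'$ of $G$ and two distinct cosets $G'+x$, $G'+y$ such that $U\subset (G'+x)\cup(G'+y)$, both $U\cap(G'+x)$ and $U\cap(G'+y)$ are $(d-1)$-dimensional quasicubes, and $x-y$ has infinite order in $G/G'$. *)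

(* Defs.v *)
From HB Require Import structures.
From mathcomp Require Import all_boot all_order all_algebra.
From mathcomp Require Import finmap.
From mathcomp Require Import boolp classical_sets reals exp.
Set Implicit Arguments.
Unset Strict Implicit.
Unset Printing Implicit Defensive.
Import Order.TTheory GRing.Theory Num.Theory.
Local Open Scope fset_scope.
Local Open Scope ring_scope.

(* A commutative group written additively is a zmodType (zmodTypes carry a
   choice structure, so finite subsets are {fset G}). *)

Definition sumset (G : zmodType) (A B : {fset G}) : {fset G} :=
  [fset (a + b)%R | a in A, b in B].

Definition beta_p (R : realType) (G : zmodType) (p : R) (U : {fset G}) : R :=
  inf [set r : R | exists (A B : {fset G}),
        [/\ A != fset0, B != fset0 &
            r = (#|` sumset (sumset A B) U|)%:R /
                (((#|` A|)%:R) `^ (p^-1) * ((#|` B|)%:R) `^ (1 - p^-1))]]%classic.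

Definition is_subgroup (G : zmodType) (H : G -> Prop) : Prop :=
  [/\ H 0, (forall x y, H x -> H y -> H (x + y)) & (forall x, H x -> H (- x))].

(* d-dimensional quasicubes, following the recursive definition.
   The coset H + x is {g | H (g - x)}; U \cap (H + x) is described by
   membership; "x - y has infinite order in G/H" means no positive multiple
   of x - y lies in H. *)
Inductive quasicube (G : zmodType) : nat -> {fset G} -> Prop :=
| quasicube0 (g : G) : quasicube 0 [fset g]
| quasicubeS (d : nat) (U Ux Uy : {fset G}) (H : G -> Prop) (x y : G) :
    is_subgroup H ->
    (exists g, ~ H g) ->
    ~ H (x - y) ->
    (forall u, u \in U -> H (u - x) \/ H (u - y)) ->
    (forall u, u \in Ux <-> (u \in U /\ H (u - x))) ->
    (forall u, u \in Uy <-> (u \in U /\ H (u - y))) ->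
    quasicube d Ux -> quasicube d Uy ->
    (forall n : nat, (0 < n)%N -> ~ H ((x - y) *+ n)) ->
    quasicube d.+1 U.

(* Main.v *)
(* Write u = 1/p, v = 1/q and k = p^u q^v. The bound c^d |V| |A|^u |B|^v <=
   |A + B + V| is proved by induction on d. Let U lie in two cosets of H
   differing by t, of infinite order modulo H. By pairing the parts of A in the
   cosets of H + Zt with the largest such part of B, and conversely, one may
   assume that A and B each lie in a single coset of H + Zt. Slicing along the
   cosets of H gives sizes a_i, b_j (i, j in Z), and the induction hypothesis
   reduces the claim to the inequality
     sum_k S_k >= (k / 2) (x + y) (sum a_i)^u (sum b_j)^v
   for S_(i+j) >= x a_i^u b_j^v and S_(i+j+1) >= y a_i^u b_j^v. For y = e x with
   e <= 1, refine Z to (1/N)Z with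
     a_(n+s) = a_n e^(ps), b_(n+s) = b_n e^(qs), S_(n+s) = S_n e^s, 0 <= s < 1:
   both hypotheses become one, to which a discrete Prekopa-Leindler inequality
   applies. Hoelder's inequality and 2 sum_s e^(2s) >= (1 + e) sum_s e^s then
   give the claim as N goes to infinity. *)
Require Import Defs.
From HB Require Import structures.
From mathcomp Require Import all_boot all_order all_algebra.
From mathcomp Require Import finmap.
From mathcomp Require Import boolp reals exp hoelder.
From mathcomp Require Import zify ring lra.
Set Implicit Arguments.
Unset Strict Implicit.
Unset Printing Implicit Defensive.
Import Order.TTheory GRing.Theory Num.Theory.
Local Open Scope fset_scope.
Local Open Scope ring_scope.

(** * Weighted geometric means *)

Definition gmean (R : realType) (u v x y : R) : R := x `^ u * y `^ v.

Lemma gmeanC (R : realType) (u v x y : R) : gmean u v x y = gmean v u y x.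
Proof. exact: mulrC. Qed.

Definition quasicube_const (R : realType) (u v : R) : R :=
  gmean u v u^-1 v^-1 / 2.

Section WeightedGeometricMean.
Variables (R : realType) (u v : R).
Hypotheses (u_gt0 : 0 < u) (v_gt0 : 0 < v) (uvD1 : u + v = 1).
Local Notation gmean := (gmean u v).

Lemma gmean_ge0 x y : 0 <= gmean x y.
Proof. by rewrite mulr_ge0 ?powR_ge0. Qed.

Lemma gmean_gt0 x y : 0 < x -> 0 < y -> 0 < gmean x y.
Proof. by move=> x0 y0; rewrite mulr_gt0 ?powR_gt0. Qed.

Lemma gmean0l y : gmean 0 y = 0.
Proof. by rewrite /gmean powR0 ?mul0r ?gt_eqF. Qed.

Lemma gmean0r x : gmean x 0 = 0.
Proof. by rewrite /gmean powR0 ?mulr0 ?gt_eqF. Qed.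

Lemma gmeanxx x : 0 <= x -> gmean x x = x.
Proof. by move=> x0; rewrite /gmean -powRD ?uvD1 ?powRr1 ?oner_eq0. Qed.

Lemma gmeanM x y x' y' : 0 <= x -> 0 <= y -> 0 <= x' -> 0 <= y' ->
  gmean (x * x') (y * y') = gmean x y * gmean x' y'.
Proof. by move=> *; rewrite /gmean !powRM// mulrACA. Qed.

Lemma gmeanZ c x y : 0 <= c -> 0 <= x -> 0 <= y ->
  gmean (c * x) (c * y) = c * gmean x y.
Proof. by move=> *; rewrite gmeanM ?gmeanxx. Qed.

Lemma gmean_div x y x' y' : 0 <= x -> 0 <= y -> 0 < x' -> 0 < y' ->
  gmean (x / x') (y / y') = gmean x y / gmean x' y'.
Proof.
move=> x0 y0 x'0 y'0; have /gt_eqF/negbT nz := gmean_gt0 x'0 y'0.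
rewrite -[LHS](mulfK nz) -gmeanM ?divr_ge0 ?(ltW x'0) ?(ltW y'0)//.
by rewrite !divfK ?gt_eqF.
Qed.

Lemma ler_gmean x y x' y' : 0 <= x -> 0 <= y -> x <= x' -> y <= y' ->
  gmean x y <= gmean x' y'.
Proof.
move=> x0 y0 xx' yy'; apply: ler_pM; rewrite ?powR_ge0//.
  by apply: ge0_ler_powR; rewrite ?nnegrE ?(ltW u_gt0) ?(le_trans x0).
by apply: ge0_ler_powR; rewrite ?nnegrE ?(ltW v_gt0) ?(le_trans y0).
Qed.

Lemma min_le_gmean x y : 0 <= x -> 0 <= y -> Num.min x y <= gmean x y.
Proof.
move=> x0 y0; have m0 : 0 <= Num.min x y by rewrite le_min x0.
by rewrite -[leLHS]gmeanxx// ler_gmean// ge_min lexx ?orbT.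
Qed.

Lemma gmean_le_amean x y : 0 <= x -> 0 <= y -> gmean x y <= u * x + v * y.
Proof.
move=> x0 y0.
have := @conjugate_powR R (x `^ u) (y `^ v) u^-1 v^-1 (powR_ge0 _ _)
  (powR_ge0 _ _).
rewrite !invr_gt0 !invrK => /(_ u_gt0 v_gt0 uvD1).
by rewrite -!powRrM !mulfV ?gt_eqF// !powRr1// [x * u]mulrC [y * v]mulrC.
Qed.

Lemma quasicube_const_ge0 : 0 <= quasicube_const u v.
Proof. by rewrite divr_ge0 ?gmean_ge0. Qed.

Lemma quasicube_const_le1 : quasicube_const u v <= 1.
Proof.
have [ui vi] : 0 <= u^-1 /\ 0 <= v^-1 by rewrite !invr_ge0 !ltW.
rewrite ler_pdivrMr// mul1r; apply: le_trans (gmean_le_amean ui vi) _.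
by rewrite !mulfV ?gt_eqF.
Qed.

Lemma gmean_inv_le_add x y : 0 <= x -> 0 <= y ->
  gmean u^-1 v^-1 * gmean x y <= x + y.
Proof.
move=> x0 y0; have [ui vi] : 0 <= u^-1 /\ 0 <= v^-1 by rewrite !invr_ge0 !ltW.
rewrite -gmeanM//; apply: le_trans (gmean_le_amean _ _) _; rewrite ?mulr_ge0//.
by rewrite !mulVKf ?gt_eqF.
Qed.

Lemma gmean_powR_inv t m n : 0 <= t ->
  gmean ((t `^ u^-1) ^+ m) ((t `^ v^-1) ^+ n) = t ^+ (m + n).
Proof.
move=> t0; have root w k : 0 < w -> ((t `^ w^-1) ^+ k) `^ w = t ^+ k.
  move=> w0; rewrite -powR_mulrn ?powR_ge0// powRAC -(powRrM t) mulVf ?gt_eqF//.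
  by rewrite powRr1// powR_mulrn.
by rewrite /gmean !root// exprD.
Qed.

Lemma gmeanD_le x y x' y' : 0 <= x -> 0 <= y -> 0 <= x' -> 0 <= y' ->
  gmean x y + gmean x' y' <= gmean (x + x') (y + y').
Proof.
move=> x0 y0 x'0 y'0; have [ui vi] : 0 < u^-1 /\ 0 < v^-1 by rewrite !invr_gt0.
have := @hoelder2 R (x `^ u) (x' `^ u) (y `^ v) (y' `^ v) u^-1 v^-1.
rewrite !invrK -!powRrM !mulfV ?gt_eqF// !powRr1//.
by apply; rewrite ?powR_ge0.
Qed.

Lemma sum_gmean_le (I : Type) (r : seq I) (x y : I -> R) :
  (forall i, 0 <= x i) -> (forall i, 0 <= y i) ->
  \sum_(i <- r) gmean (x i) (y i) <=
  gmean (\sum_(i <- r) x i) (\sum_(i <- r) y i).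
Proof.
move=> x0 y0; elim: r => [|i r IH]; first by rewrite !big_nil gmean0l.
rewrite !big_cons; apply: le_trans (gmeanD_le _ _ _ _); rewrite ?sumr_ge0//.
by rewrite lerD2l.
Qed.

End WeightedGeometricMean.

(** * Finite sets and sumsets *)

Lemma fset_argmin (T : choiceType) (disp : Order.disp_t) (D : orderType disp)
    (F : T -> D) (X : {fset T}) :
  X != fset0 -> exists2 x, x \in X & {in X, forall y, (F x <= F y)%O}.
Proof.
move=> /fset0Pn[x0 x0X].
have [x _ xP] := @arg_minP _ _ X [` x0X] xpredT (F \o val) isT.
by exists (val x) => [|y yX]; [exact: valP|exact: (xP [` yX])].
Qed.

Lemma fset_argmax (T : choiceType) (disp : Order.disp_t) (D : orderType disp)
    (F : T -> D) (X : {fset T}) :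
  X != fset0 -> exists2 x, x \in X & {in X, forall y, (F y <= F x)%O}.
Proof. exact: (@fset_argmin T _ D^d F). Qed.

Lemma ler_sum_fsubset (T : choiceType) (R : numDomainType) (F : T -> R)
    (X Y : {fset T}) :
  X `<=` Y -> {in Y, forall y, 0 <= F y} ->
  \sum_(x <- X) F x <= \sum_(y <- Y) F y.
Proof.
move=> XY F_ge0; have -> : X = [fset y in Y | y \in X].
  apply/fsetP => x; rewrite !inE andbC.
  by case: (boolP (x \in X)) => // /(fsubsetP XY).
rewrite -big_fset_condE [leRHS](bigID (mem X))/= lerDl.
by rewrite big_seq_cond sumr_ge0// => x /andP[/F_ge0].
Qed.

Lemma sumsetP (G : zmodType) (A B : {fset G}) (c : G) :
  reflect (exists a b, [/\ a \in A, b \in B & c = a + b]) (c \in sumset A B).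
Proof.
apply: (iffP (imfset2P _ _ _ _ _)) => [[a aA [b bB ->]]|[a [b [aA bB ->]]]].
  by exists a, b.
by exists a => //; exists b.
Qed.

Lemma mem_sumset (G : zmodType) (A B : {fset G}) (a b : G) :
  a \in A -> b \in B -> a + b \in sumset A B.
Proof. by move=> aA bB; apply/sumsetP; exists a, b. Qed.

Lemma sumsetC (G : zmodType) (A B : {fset G}) : sumset A B = sumset B A.
Proof.
apply/fsetP => c; apply/sumsetP/sumsetP => -[a [b [aA bB ->]]];
by exists b, a; rewrite addrC.
Qed.

Lemma sumsetS (G : zmodType) (A A' B B' : {fset G}) :
  A `<=` A' -> B `<=` B' -> sumset A B `<=` sumset A' B'.
Proof.
move=> /fsubsetP AA' /fsubsetP BB'; apply/fsubsetP => c.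
by move=> /sumsetP[a [b [/AA' aA /BB' bB ->]]]; exact: mem_sumset.
Qed.

Lemma sumset0l (G : zmodType) (A : {fset G}) : sumset fset0 A = fset0.
Proof. by apply/fsetP => c; apply/sumsetP => -[a [b []]]. Qed.

Lemma card_fset_addr (G : zmodType) (A : {fset G}) (b : G) :
  #|` [fset a + b | a in A]| = #|` A|.
Proof. by rewrite card_imfset//; exact: addIr. Qed.

Lemma fset_addr_sub_sumset (G : zmodType) (A B : {fset G}) (b : G) :
  b \in B -> [fset a + b | a in A] `<=` sumset A B.
Proof.
by move=> bB; apply/fsubsetP => _ /imfsetP[a aA ->]; exact: mem_sumset.
Qed.

Lemma card_sumset_ge (G : zmodType) (A B : {fset G}) :
  B != fset0 -> (#|` A| <= #|` sumset A B|)%N.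
Proof.
move=> /fset0Pn[b bB]; rewrite -(card_fset_addr A b) fsubset_leq_card//.
exact: fset_addr_sub_sumset.
Qed.

Lemma card_sumset_geD (D : realDomainType) (X Y : {fset D}) :
  X != fset0 -> Y != fset0 -> (#|` X| + #|` Y| <= #|` sumset X Y|.+1)%N.
Proof.
move=> X_neq0 Y_neq0; have [x1 x1X x1P] := fset_argmax id X_neq0.
have [y0 y0Y y0P] := fset_argmin id Y_neq0.
rewrite -(card_fset_addr X y0) -(card_fset_addr Y x1) -cardfsUI -addn1.
rewrite leq_add//.
  rewrite fsubset_leq_card// fsubUset fset_addr_sub_sumset//= sumsetC.
  exact: fset_addr_sub_sumset.
rewrite -(cardfs1 (x1 + y0)) fsubset_leq_card//; apply/fsubsetP => z.
rewrite !inE => /andP[/imfsetP[x /= xX ->] /imfsetP[y /= yY xyE]].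
have := x1P x xX; have := y0P y yY; rewrite /= => y0y xx1.
by apply/eqP/le_anti; rewrite lerD2r xx1/= xyE addrC lerD2r.
Qed.

(** * A discrete Prekopa-Leindler inequality *)

Section Superlevel.
Variables (T : choiceType) (R : realDomainType) (F : T -> R).
Implicit Types (X : {fset T}) (m : R) (x : T).

Definition superlevel X m : {fset T} := [fset x in X | m < F x].

Lemma in_superlevel X m x : (x \in superlevel X m) = (x \in X) && (m < F x).
Proof. by rewrite !inE. Qed.

Lemma superlevel_sub X m : superlevel X m `<=` X.
Proof. by apply/fsubsetP => x; rewrite in_superlevel => /andP[]. Qed.

Lemma superlevel_eq0 X m : {in X, forall x, F x <= m} -> superlevel X m = fset0.
Proof.
move=> Fm; apply/fsetP => x; rewrite in_superlevel inE.
by apply/negP => /andP[/Fm]; rewrite leNgt => /negP.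
Qed.

Lemma card_superlevel_lt X m x :
  x \in X -> F x <= m -> (#|` superlevel X m| < #|` X|)%N.
Proof.
move=> xX Fxm; rewrite fproper_ltn_card// fproperE superlevel_sub/=.
by apply/fsubsetPn; exists x; rewrite // in_superlevel xX -leNgt.
Qed.

Lemma sum_superlevel X m : {in X, forall x, m <= F x} ->
  \sum_(x <- X) F x = m *+ #|` X| + \sum_(x <- superlevel X m) (F x - m).
Proof.
move=> mF; have -> : \sum_(x <- superlevel X m) (F x - m) =
    \sum_(x <- X) (F x - m).
  apply: big_fset_incl (superlevel_sub X m) _ => x xX.
  rewrite in_superlevel xX/= -leNgt => Fm; apply/eqP.
  by rewrite subr_eq0 eq_le Fm mF.
by rewrite sumrB big_const_seq count_predT iter_addr_0 addrC subrK.
Qed.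

End Superlevel.

Lemma ler_sum_sumset_of_superlevel (D R : realDomainType) (f g h : D -> R)
    (X Y : {fset D}) (m M : R) :
  X != fset0 -> Y != fset0 -> 0 <= m ->
  {in X, forall x, m <= f x} -> {in Y, forall y, m <= g y} ->
  {in X & Y, forall x y, Num.min (f x) (g y) <= h (x + y)} ->
  \sum_(x <- superlevel f X m) (f x - m) +
    \sum_(y <- superlevel g Y m) (g y - m) <=
  \sum_(z <- sumset (superlevel f X m) (superlevel g Y m)) (h z - m) +
    (M - m) ->
  \sum_(x <- X) f x + \sum_(y <- Y) g y <= \sum_(z <- sumset X Y) h z + M.
Proof.
move=> X_neq0 Y_neq0 m_ge0 mf mg hP.
have mh : {in sumset X Y, forall z, 0 <= h z - m}.
  move=> _ /sumsetP[x [y [xX yY ->]]]; rewrite subr_ge0.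
  by apply: le_trans (hP _ _ xX yY); rewrite le_min mf ?mg.
have := ler_sum_fsubset
  (sumsetS (superlevel_sub f X m) (superlevel_sub g Y m)) mh.
have := ler_wpMn2l m_ge0 (card_sumset_geD X_neq0 Y_neq0).
have := sumrB (sumset X Y) xpredT h (fun=> m).
rewrite big_const_seq count_predT iter_addr_0.
by rewrite (sum_superlevel mf) (sum_superlevel mg) mulrSr mulrnDr; lra.
Qed.

(* Layer-cake induction: the layer below the smallest value m of f and g is
   handled by card_sumset_geD; the points where m is attained then drop out. *)
Lemma discrete_prekopa_leindler (D R : realDomainType) (f g h : D -> R)
    (X Y : {fset D}) (x0 y0 : D) :
  x0 \in X -> y0 \in Y -> f x0 = g y0 ->
  {in X, forall x, 0 <= f x <= f x0} -> {in Y, forall y, 0 <= g y <= g y0} ->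
  {in X & Y, forall x y, Num.min (f x) (g y) <= h (x + y)} ->
  \sum_(x <- X) f x + \sum_(y <- Y) g y <= \sum_(z <- sumset X Y) h z + f x0.
Proof.
have [n] := ubnP (#|` X| + #|` Y|); elim: n f g h X Y => // n IH f g h X Y.
move=> card_lt x0X y0Y fgE fP gP hP.
have [X_neq0 Y_neq0] : X != fset0 /\ Y != fset0.
  by split; apply/fset0Pn; [exists x0|exists y0].
have [xm xmX xmP] := fset_argmin f X_neq0.
have [ym ymY ymP] := fset_argmin g Y_neq0.
pose m := Num.min (f xm) (g ym).
have mf : {in X, forall x, m <= f x} by move=> x xX; rewrite ge_min xmP.
have mg : {in Y, forall y, m <= g y} by move=> y yY; rewrite ge_min ymP ?orbT.
apply: (@ler_sum_sumset_of_superlevel _ _ _ _ _ _ _ m) => //.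
  by rewrite le_min; case/andP: (fP _ xmX) (gP _ ymY) => -> _ /andP[].
have [f_lem|m_ltf] := leP (f x0) m.
  rewrite !superlevel_eq0 ?sumset0l ?big_seq_fset0 ?addr0 ?add0r ?subr_ge0.
  - exact: mf.
  - by move=> y /gP/andP[_ gy]; rewrite (le_trans gy)// -fgE.
  - by move=> x /fP/andP[_ fx]; rewrite (le_trans fx).
have XX := fsubsetP (superlevel_sub f X m).
have YY := fsubsetP (superlevel_sub g Y m).
have card'_lt : (#|` superlevel f X m| + #|` superlevel g Y m| < n)%N.
  rewrite -ltnS (leq_trans _ card_lt)// ltnS.
  have [fg|gf] := leP (f xm) (g ym).
    rewrite -addSn leq_add ?fsubset_leq_card ?superlevel_sub//.
    by apply: card_superlevel_lt xmX _; rewrite le_min lexx.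
  rewrite -addnS leq_add ?fsubset_leq_card ?superlevel_sub//.
  by apply: card_superlevel_lt ymY _; rewrite le_min lexx ltW.
apply: (IH (fun x => f x - m) (fun y => g y - m) (fun z => h z - m)) => //.
- by rewrite in_superlevel x0X.
- by rewrite in_superlevel y0Y -fgE.
- by rewrite fgE.
- by move=> x /XX xX; rewrite subr_ge0 mf// lerD2r; case/andP: (fP _ xX).
- by move=> y /YY yY; rewrite subr_ge0 mg// lerD2r; case/andP: (gP _ yY).
- by move=> x y /XX xX /YY yY; have := hP _ _ xX yY; rewrite !ge_min !lerD2r.
Qed.

Lemma fset_argmax_sum_neq0 (T : choiceType) (R : realDomainType) (F : T -> R)
    (X : {fset T}) :
  {in X, forall x, 0 <= F x} -> \sum_(x <- X) F x != 0 ->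
  exists x0, [/\ x0 \in X, 0 < F x0 & {in X, forall x, 0 <= F x <= F x0}].
Proof.
move=> F_ge0 sumF_neq0; have [|x0 x0X x0P] := fset_argmax F (X := X).
  by apply: contraNneq sumF_neq0 => ->; rewrite big_seq_fset0.
have FP : {in X, forall x, 0 <= F x <= F x0}.
  by move=> x xX; rewrite F_ge0// x0P.
exists x0; split=> //; rewrite lt_def F_ge0// andbT.
apply: contraNneq sumF_neq0 => Fx0.
by rewrite big1_seq// => x /FP; rewrite Fx0 => /le_anti.
Qed.

Lemma gmean_prekopa_leindler (D : realDomainType) (R : realType) (u v : R)
    (f g h : D -> R) (X Y : {fset D}) (x0 y0 : D) :
  0 < u -> 0 < v -> u + v = 1 ->
  x0 \in X -> y0 \in Y -> 0 < f x0 -> 0 < g y0 ->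
  {in X, forall x, 0 <= f x <= f x0} -> {in Y, forall y, 0 <= g y <= g y0} ->
  {in X & Y, forall x y, gmean u v (f x) (g y) <= h (x + y)} ->
  gmean u v u^-1 v^-1 * gmean u v (\sum_(x <- X) f x) (\sum_(y <- Y) g y) <=
  \sum_(z <- sumset X Y) h z + gmean u v (f x0) (g y0).
Proof.
move=> u_gt0 v_gt0 uvD1 x0X y0Y f_gt0 g_gt0 fP gP hP.
set M := gmean u v (f x0) (g y0).
have M_gt0 : 0 < M by exact: gmean_gt0.
have Minv_gt0 : 0 < M^-1 by rewrite invr_gt0.
have f_sum_ge0 : 0 <= \sum_(x <- X) f x.
  by rewrite big_seq sumr_ge0// => x /fP/andP[].
have g_sum_ge0 : 0 <= \sum_(y <- Y) g y.
  by rewrite big_seq sumr_ge0// => y /gP/andP[].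
have := @discrete_prekopa_leindler D R (fun x => f x / f x0)
  (fun y => g y / g y0) (fun z => h z / M) X Y x0 y0 x0X y0Y.
rewrite -!mulr_suml !divff ?gt_eqF// => /(_ erefl) prekopa.
rewrite -(ler_pM2r Minv_gt0) -mulrA -gmean_div// mulrDl divff ?gt_eqF//.
apply: le_trans (gmean_inv_le_add _ _ _ _ _) (prekopa _ _ _) => //.
- by rewrite divr_ge0 ?(ltW f_gt0).
- by rewrite divr_ge0 ?(ltW g_gt0).
- move=> x /fP/andP[fx ?].
  by rewrite divr_ge0 ?(ltW f_gt0)//= ler_pdivrMr// mul1r.
- move=> y /gP/andP[gy ?].
  by rewrite divr_ge0 ?(ltW g_gt0)//= ler_pdivrMr// mul1r.
- move=> x y xX yY; case/andP: (fP _ xX) (gP _ yY) => fx _ /andP[gy _].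
  apply: le_trans (min_le_gmean u_gt0 v_gt0 uvD1 _ _) _.
  + by rewrite divr_ge0 ?(ltW f_gt0).
  + by rewrite divr_ge0 ?(ltW g_gt0).
  + by rewrite gmean_div// ler_pM2r ?hP.
Qed.

(** * The two-point inequality on the integers *)

Definition two_point_sumset (X Y : {fset int}) : {fset int} :=
  sumset (sumset X Y) [fset 0; 1].

Lemma two_point_sumsetP (X Y : {fset int}) (k : int) :
  reflect (exists i j (carry : bool),
             [/\ i \in X, j \in Y & k = i + j + carry%:Z])
    (k \in two_point_sumset X Y).
Proof.
apply: (iffP (sumsetP _ _ _)) => [[_ [d [/sumsetP[i [j [iX jY ->]]] d01 ->]]]|].
  exists i, j, (d == 1); split=> //.
  by move: d01; rewrite !inE => /orP[] /eqP ->.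
move=> [i [j [carry [iX jY ->]]]]; exists (i + j), carry%:Z.
by rewrite mem_sumset//; split=> //; rewrite !inE; case: carry.
Qed.

Section Refinement.
Variables (R : pzRingType) (N : nat).
Implicit Types (X Y : {fset int}) (F : int -> R).

Definition refine_set X : {fset int} :=
  [fset i * N%:Z + (s : nat)%:Z | i : int in X, s : 'I_N in 'I_N].

Definition refine_fun (t : R) F (x : int) : R :=
  F (x %/ N%:Z)%Z * t ^+ `|(x %% N%:Z)%Z|%N.

Lemma divz_digits (i : int) s : (s < N)%N -> ((i * N%:Z + s%:Z) %/ N%:Z)%Z = i.
Proof. by move=> sN; rewrite divzMDl ?divz_small ?addr0//; lia. Qed.

Lemma modz_digits (i : int) s : (s < N)%N -> ((i * N%:Z + s%:Z) %% N%:Z)%Z = s.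
Proof. by move=> sN; rewrite modzMDl modz_small//; lia. Qed.

Lemma add_digits (i j : int) s r : (s < N)%N -> (r < N)%N ->
  exists (carry : bool) q, [/\ (q < N)%N, (s + r = carry * N + q)%N &
    i * N%:Z + s%:Z + (j * N%:Z + r%:Z) = (i + j + carry%:Z) * N%:Z + q%:Z].
Proof.
move=> sN rN; exists (N <= s + r)%N, (s + r - (N <= s + r) * N)%N.
by case: leqP => srN /=; split; lia.
Qed.

Lemma refine_setP X x :
  reflect (exists i s, [/\ i \in X, (s < N)%N & x = i * N%:Z + s%:Z])
    (x \in refine_set X).
Proof.
apply: (iffP (imfset2P _ _ _ _ _)) => [[i iX [s _ ->]]|[i [s [iX sN ->]]]].
  by exists i, s.
by exists i => //; exists (Ordinal sN).
Qed.

Lemma refine_funE t F i s : (s < N)%N ->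
  refine_fun t F (i * N%:Z + s%:Z) = F i * t ^+ s.
Proof. by move=> sN; rewrite /refine_fun divz_digits// modz_digits. Qed.

Lemma sum_refine t F X :
  \sum_(x <- refine_set X) refine_fun t F x =
  (\sum_(i <- X) F i) * \sum_(s < N) t ^+ s.
Proof.
rewrite big_imfset2 /=; last first.
  move=> [i s] [j r] _ _ /= digitsE; have ij : i = j.
    by rewrite -(divz_digits i (ltn_ord s)) digitsE divz_digits.
  have /eqP sr : (s : nat)%:Z = (r : nat)%:Z.
    by rewrite -(modz_digits i (ltn_ord s)) digitsE modz_digits.
  by rewrite ij; congr existT; exact/val_inj/eqP.
rewrite mulr_suml; apply: eq_bigr => i _; rewrite mulr_sumr big_enum.
by apply: eq_bigr => s _; rewrite refine_funE.
Qed.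

Lemma sumset_refine X Y : sumset (refine_set X) (refine_set Y) `<=`
  refine_set (two_point_sumset X Y).
Proof.
apply/fsubsetP => _ /sumsetP[_ [_ [/refine_setP[i [s [iX sN ->]]]
  /refine_setP[j [r [jY rN ->]]] ->]]].
have [carry [q [qN _ ->]]] := add_digits i j sN rN.
apply/refine_setP; exists (i + j + carry%:Z), q; split=> //.
by apply/two_point_sumsetP; exists i, j, carry.
Qed.

End Refinement.

Lemma refine_fun_le (R : numDomainType) (N : nat) (t c : R) (F : int -> R)
    (X : {fset int}) :
  0 <= t <= 1 -> {in X, forall i, 0 <= F i <= c} ->
  {in refine_set N X, forall x, 0 <= refine_fun N t F x <= c}.
Proof.
move=> /andP[t_ge0 t_le1] FP x.
move=> /refine_setP[i [s [/FP/andP[Fi_ge0 Fi_le] sN ->]]].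
rewrite refine_funE// mulr_ge0 ?exprn_ge0//= (le_trans _ Fi_le)//.
by rewrite ler_piMr// exprn_ile1.
Qed.

Lemma geometric_sum_double (R : comPzRingType) (t : R) (N : nat) :
  (1 + t ^+ N) * \sum_(s < N) t ^+ s = (1 + t) * \sum_(s < N) t ^+ (s + s).
Proof.
elim: N => [|N IH]; first by rewrite !big_ord0 !mulr0.
rewrite !big_ord_recr/= [RHS]mulrDr -IH exprS exprD.
have := subrX1 t N; set W := \sum_(i < N) t ^+ i; set y := t ^+ N => yE.
have {yE} -> : y = t * W - W + 1 by rewrite -(subrK 1 y) yE; ring.
ring.
Qed.

Lemma le_of_le_add_divn (R : archiRealFieldType) (x y c : R) :
  (forall n : nat, (0 < n)%N -> x <= y + c / n%:R) -> x <= y.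
Proof.
move=> xyc; apply/ler_addgt0Pr => e e_gt0.
have := archi_boundP (normr_ge0 (c / e)).
set n := Num.bound _ => n_gt; have n_gt0 : 0 < n%:R :> R.
  exact: le_lt_trans (normr_ge0 _) n_gt.
apply: le_trans (xyc n _) _; first by rewrite -(ltr0n R).
rewrite lerD2l ler_pdivrMr// mulrC -ler_pdivrMr//.
exact: le_trans (ler_norm _) (ltW n_gt).
Qed.

Section TwoPoint.
Variables (R : realType) (u v : R).
Hypotheses (u_gt0 : 0 < u) (v_gt0 : 0 < v) (uvD1 : u + v = 1).
Implicit Types (a b S : int -> R) (X Y : {fset int}).

Lemma two_point_ge0 a b S X Y (c c' : R) : 0 <= c -> 0 <= c' ->
  {in X & Y, forall i j, c * gmean u v (a i) (b j) <= S (i + j)} ->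
  {in X & Y, forall i j, c' * gmean u v (a i) (b j) <= S (i + j + 1)} ->
  {in two_point_sumset X Y, forall k, 0 <= S k}.
Proof.
move=> c_ge0 c'_ge0 S_ge S_shift_ge k.
move=> /two_point_sumsetP[i [j [carry [iX jY ->]]]].
case: carry; last rewrite addr0.
  by apply: le_trans (S_shift_ge _ _ iX jY); rewrite mulr_ge0 ?gmean_ge0.
by apply: le_trans (S_ge _ _ iX jY); rewrite mulr_ge0 ?gmean_ge0.
Qed.

Lemma gmean_refine_fun_le a b S X Y (t : R) (N : nat) : 0 <= t ->
  {in X, forall i, 0 <= a i} -> {in Y, forall j, 0 <= b j} ->
  {in X & Y, forall i j, gmean u v (a i) (b j) <= S (i + j)} ->
  {in X & Y, forall i j, t ^+ N * gmean u v (a i) (b j) <= S (i + j + 1)} ->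
  {in refine_set N X & refine_set N Y, forall x y,
    gmean u v (refine_fun N (t `^ u^-1) a x) (refine_fun N (t `^ v^-1) b y) <=
    refine_fun N t S (x + y)}.
Proof.
move=> t_ge0 a_ge0 b_ge0 S_ge S_shift_ge.
move=> _ _ /refine_setP[i [s [iX sN ->]]] /refine_setP[j [r [jY rN ->]]].
have [carry [q [qN srE ->]]] := add_digits i j sN rN.
rewrite !refine_funE// gmeanM ?exprn_ge0 ?powR_ge0 ?a_ge0 ?b_ge0//.
rewrite gmean_powR_inv// srE exprD mulrA ler_wpM2r ?exprn_ge0//.
case: carry {srE} => /=; last by rewrite mul0n mulr1 addr0 S_ge.
by rewrite mul1n mulrC S_shift_ge.
Qed.

Lemma geometric_sum_gmean_ge (t : R) (N : nat) : 0 <= t <= 1 ->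
  (1 + t ^+ N) / 2 * \sum_(s < N) t ^+ s <=
  gmean u v (\sum_(s < N) (t `^ u^-1) ^+ s) (\sum_(s < N) (t `^ v^-1) ^+ s).
Proof.
move=> /andP[t_ge0 t_le1].
apply: (@le_trans _ _ (\sum_(s < N) t ^+ (s + s))).
  rewrite mulrAC geometric_sum_double mulrAC ler_piMl ?sumr_ge0//; last by lra.
  by move=> s _; exact: exprn_ge0.
under eq_bigr => s _ do rewrite -(gmean_powR_inv u_gt0 v_gt0 s s t_ge0).
by apply: sum_gmean_le => // s; rewrite exprn_ge0 ?powR_ge0.
Qed.

(* Each unit interval is refined into N points carrying geometric weights, tuned
   so that the two hypotheses on S merge into a single one. *)
Lemma refined_prekopa_leindler a b S X Y (t : R) (i0 j0 : int) (N : nat) :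
  0 < t <= 1 -> (0 < N)%N -> i0 \in X -> j0 \in Y -> 0 < a i0 -> 0 < b j0 ->
  {in X, forall i, 0 <= a i <= a i0} -> {in Y, forall j, 0 <= b j <= b j0} ->
  {in X & Y, forall i j, gmean u v (a i) (b j) <= S (i + j)} ->
  {in X & Y, forall i j, t ^+ N * gmean u v (a i) (b j) <= S (i + j + 1)} ->
  gmean u v u^-1 v^-1 *
    gmean u v ((\sum_(i <- X) a i) * \sum_(s < N) (t `^ u^-1) ^+ s)
              ((\sum_(j <- Y) b j) * \sum_(s < N) (t `^ v^-1) ^+ s) <=
  (\sum_(k <- two_point_sumset X Y) S k) * \sum_(s < N) t ^+ s +
    gmean u v (a i0) (b j0).
Proof.
move=> /andP[t_gt0 t_le1] N_gt0 i0X j0Y a_gt0 b_gt0 aP bP S_ge S_shift_ge.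
have root01 w : 0 < w -> 0 <= t `^ w^-1 <= 1.
  move=> w_gt0; rewrite powR_ge0/= -[leRHS](powRr0 t).
  by rewrite ger_powR ?t_gt0 ?invr_ge0 ?(ltW w_gt0).
have [a_ge0 b_ge0] : {in X, forall i, 0 <= a i} /\ {in Y, forall j, 0 <= b j}.
  by split=> [i /aP/andP[]|j /bP/andP[]].
have S_ge0 : {in two_point_sumset X Y, forall k, 0 <= S k}.
  apply: two_point_ge0 ler01 (exprn_ge0 N (ltW t_gt0)) _ S_shift_ge.
  by move=> i j iX jY; rewrite mul1r S_ge.
have origin (w : R) F (k : int) : refine_fun N w F (k * N%:Z + 0%:Z) = F k.
  by rewrite refine_funE// mulr1.
rewrite -!sum_refine -(origin (t `^ u^-1) a) -(origin (t `^ v^-1) b).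
apply: (@le_trans _ _ (\sum_(z <- sumset (refine_set N X) (refine_set N Y))
    refine_fun N t S z +
    gmean u v (refine_fun N (t `^ u^-1) a (i0 * N%:Z + 0%:Z))
              (refine_fun N (t `^ v^-1) b (j0 * N%:Z + 0%:Z)))).
  apply: gmean_prekopa_leindler; rewrite ?origin//.
  - by apply/refine_setP; exists i0, 0%N.
  - by apply/refine_setP; exists j0, 0%N.
  - exact: refine_fun_le (root01 _ u_gt0) aP.
  - exact: refine_fun_le (root01 _ v_gt0) bP.
  - exact: gmean_refine_fun_le (ltW t_gt0) a_ge0 b_ge0 S_ge S_shift_ge.
rewrite lerD2r ler_sum_fsubset ?sumset_refine// => x.
move=> /refine_setP[k [s [kK sN ->]]].
by rewrite refine_funE// mulr_ge0 ?S_ge0 ?exprn_ge0 ?(ltW t_gt0).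
Qed.

Lemma two_point_prekopa_leindler_approx a b S X Y (e : R) (i0 j0 : int)
    (N : nat) :
  0 < e <= 1 -> (0 < N)%N -> i0 \in X -> j0 \in Y -> 0 < a i0 -> 0 < b j0 ->
  {in X, forall i, 0 <= a i <= a i0} -> {in Y, forall j, 0 <= b j <= b j0} ->
  {in X & Y, forall i j, gmean u v (a i) (b j) <= S (i + j)} ->
  {in X & Y, forall i j, e * gmean u v (a i) (b j) <= S (i + j + 1)} ->
  quasicube_const u v * (1 + e) *
    gmean u v (\sum_(i <- X) a i) (\sum_(j <- Y) b j) <=
  \sum_(k <- two_point_sumset X Y) S k +
    gmean u v (a i0) (b j0) / e / N%:R.
Proof.
move=> /andP[e_gt0 e_le1] N_gt0 i0X j0Y a_gt0 b_gt0 aP bP S_ge S_shift_ge.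
pose t : R := e `^ (N%:R^-1); have t_gt0 : 0 < t by exact: powR_gt0.
have t_le1 : t <= 1 by rewrite -(powRr0 e) ger_powR ?e_gt0 ?invr_ge0.
have tN : t ^+ N = e.
  rewrite -powR_mulrn ?powR_ge0// -powRrM mulVf ?pnatr_eq0 -?lt0n//.
  by rewrite powRr1 ?ltW.
have := @refined_prekopa_leindler a b S X Y t i0 j0 N.
rewrite t_gt0 t_le1 tN.
move=> /(_ isT N_gt0 i0X j0Y a_gt0 b_gt0 aP bP S_ge S_shift_ge).
have := @geometric_sum_gmean_ge t N; rewrite tN t_le1 ltW// => /(_ isT).
set A := \sum_(i <- X) a i; set B := \sum_(j <- Y) b j.
set W := \sum_(k <- _) S k; set M := gmean u v (a i0) (b j0).
set Q := \sum_(s < N) t ^+ s; set Qu := \sum_(s < N) (t `^ u^-1) ^+ s.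
set Qv := \sum_(s < N) (t `^ v^-1) ^+ s => hoelder prekopa.
have A_ge0 : 0 <= A by rewrite /A big_seq sumr_ge0// => i /aP/andP[].
have B_ge0 : 0 <= B by rewrite /B big_seq sumr_ge0// => j /bP/andP[].
have [Qu_ge0 Qv_ge0] : 0 <= Qu /\ 0 <= Qv.
  by split; rewrite sumr_ge0// => s _; rewrite exprn_ge0 ?powR_ge0.
have Q_ge : e * N%:R <= Q.
  rewrite mulr_natr -[X in _ *+ X]card_ord -sumr_const -tN.
  by apply: ler_sum => s _; rewrite ler_wiXn2l ?(ltW t_gt0)// ltnW.
have eN_gt0 : 0 < e * N%:R by rewrite mulr_gt0 ?ltr0n.
have Q_gt0 : 0 < Q by exact: lt_le_trans Q_ge.
apply: (@le_trans _ _ (W + M / Q)); last first.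
  by rewrite lerD2l -mulrA -invfM ler_wpM2l ?gmean_ge0// lef_pV2.
rewrite -(ler_pM2r Q_gt0) [leRHS]mulrDl divfK ?gt_eqF//.
apply: le_trans prekopa.
rewrite gmeanM// /quasicube_const; set k := gmean u v u^-1 v^-1.
set AB := gmean u v A B.
have -> : k / 2 * (1 + e) * AB * Q = k * (AB * ((1 + e) / 2 * Q)).
  by ring.
by rewrite !ler_wpM2l ?gmean_ge0.
Qed.

Lemma two_point_prekopa_leindler a b S X Y (c c' : R) :
  0 < c' <= c -> {in X, forall i, 0 <= a i} -> {in Y, forall j, 0 <= b j} ->
  {in X & Y, forall i j, c * gmean u v (a i) (b j) <= S (i + j)} ->
  {in X & Y, forall i j, c' * gmean u v (a i) (b j) <= S (i + j + 1)} ->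
  quasicube_const u v * (c + c') *
    gmean u v (\sum_(i <- X) a i) (\sum_(j <- Y) b j) <=
  \sum_(k <- two_point_sumset X Y) S k.
Proof.
move=> /andP[c'_gt0 c'c] a_ge0 b_ge0 S_ge S_shift_ge.
have c_gt0 : 0 < c by exact: lt_le_trans c'c.
have S_ge0 : 0 <= \sum_(k <- two_point_sumset X Y) S k.
  rewrite big_seq sumr_ge0//.
  exact: two_point_ge0 (ltW c_gt0) (ltW c'_gt0) S_ge S_shift_ge.
have [->|A_neq0] := eqVneq (\sum_(i <- X) a i) 0.
  by rewrite gmean0l ?mulr0.
have [->|B_neq0] := eqVneq (\sum_(j <- Y) b j) 0.
  by rewrite gmean0r ?mulr0.
have [i0 [i0X a_gt0 aP]] := fset_argmax_sum_neq0 a_ge0 A_neq0.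
have [j0 [j0Y b_gt0 bP]] := fset_argmax_sum_neq0 b_ge0 B_neq0.
have cinv_gt0 : 0 < c^-1 by rewrite invr_gt0.
rewrite -(ler_pM2r cinv_gt0) mulr_suml.
set k := quasicube_const u v; set AB := gmean u v _ _.
have -> : k * (c + c') * AB / c = k * (1 + c' / c) * AB.
  by field; rewrite gt_eqF.
apply: le_of_le_add_divn => N N_gt0.
apply: (@two_point_prekopa_leindler_approx _ _ _ _ _ _ i0 j0) => //.
- by rewrite divr_gt0//= ler_pdivrMr// mul1r.
- by move=> i j iX jY; rewrite ler_pdivlMr// mulrC S_ge.
- by move=> i j iX jY; rewrite mulrAC ler_pM2r ?S_shift_ge.
Qed.

End TwoPoint.

(** * Fibres of additive maps *)

Section Fiber.
Variables (T U : choiceType) (f : T -> U).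
Implicit Types (A : {fset T}) (y : U).

Definition fiber A y : {fset T} := [fset a in A | f a == y].

Lemma in_fiber A y a : (a \in fiber A y) = (a \in A) && (f a == y).
Proof. by rewrite !inE. Qed.

Lemma fiberP A y : {in fiber A y, forall a, f a = y}.
Proof. by move=> a; rewrite in_fiber => /andP[_ /eqP]. Qed.

Lemma fiber_sub A y : fiber A y `<=` A.
Proof. by apply/fsubsetP => a; rewrite in_fiber => /andP[]. Qed.

Lemma card_fiberE A y : #|` fiber A y| = \sum_(a <- A | f a == y) 1%N.
Proof. by rewrite big_fset_condE sum1_size. Qed.

Lemma sum_card_fiber A :
  \sum_(y <- [fset f a | a in A]) #|` fiber A y| = #|` A|.
Proof.
under eq_bigr do rewrite card_fiberE.
by rewrite -(partition_big_imfset _ f A (fun=> 1%N)) sum1_size.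
Qed.

Lemma sum_card_fiber_le A (r : seq U) :
  uniq r -> (\sum_(y <- r) #|` fiber A y| <= #|` A|)%N.
Proof.
move=> r_uniq; under eq_bigr do rewrite card_fiberE big_mkcond.
rewrite exchange_big -sum1_size leq_sum// => a _.
rewrite -big_mkcond sum1_count (eq_count (eq_sym (f a))).
by rewrite count_uniq_mem// leq_b1.
Qed.

Lemma max_fiber A : A != fset0 ->
  exists2 y, fiber A y != fset0 &
    forall z, (#|` fiber A z| <= #|` fiber A y|)%N.
Proof.
move=> /(fset_argmax (fun a => #|` fiber A (f a)|))[a aA aP].
exists (f a) => [|z].
  by apply/fset0Pn; exists a; rewrite in_fiber aA eqxx.
have [->|/fset0Pn[b]] := eqVneq (fiber A z) fset0; first by rewrite cardfs0.
by rewrite in_fiber => /andP[bA /eqP <-]; exact: aP.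
Qed.

End Fiber.

Section SumsetFiber.
Variables (G Q : zmodType) (f : {additive G -> Q}).

Lemma sumset_constant (A B : {fset G}) (x y : Q) :
  {in A, forall a, f a = x} -> {in B, forall b, f b = y} ->
  {in sumset A B, forall c, f c = x + y}.
Proof.
by move=> fA fB _ /sumsetP[a [b [/fA fa /fB fb ->]]]; rewrite raddfD fa fb.
Qed.

Lemma sumset3_sub_fiber (A B V A' B' V' : {fset G}) (x y z : Q) :
  A' `<=` A -> B' `<=` B -> V' `<=` V ->
  {in A', forall a, f a = x} -> {in B', forall b, f b = y} ->
  {in V', forall w, f w = z} ->
  sumset (sumset A' B') V' `<=` fiber f (sumset (sumset A B) V) (x + y + z).
Proof.
move=> AA BB VV fA fB fV; apply/fsubsetP => c cABV; rewrite in_fiber.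
rewrite (fsubsetP (sumsetS (sumsetS AA BB) VV)) //.
by rewrite (sumset_constant (sumset_constant fA fB) fV cABV) eqxx.
Qed.

End SumsetFiber.

Section SumsetBound.
Variables (R : realType) (G : zmodType).

(* Empty A and B are harmless: gmean u v vanishes there for positive u and v. *)
Definition sumset_bound (u v C : R) (V : {fset G}) : Prop :=
  forall A B : {fset G},
    C * gmean u v #|` A|%:R #|` B|%:R <= #|` sumset (sumset A B) V|%:R.

Variables (u v : R).
Hypotheses (u_gt0 : 0 < u) (v_gt0 : 0 < v) (uvD1 : u + v = 1).

Lemma sumset_bound_le (C C' : R) (V V' : {fset G}) :
  C' <= C -> V `<=` V' -> sumset_bound u v C V -> sumset_bound u v C' V'.
Proof.
move=> C'C VV' bV A B; apply: le_trans (ler_wpM2r (gmean_ge0 _ _ _ _) C'C) _.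
apply: le_trans (bV A B) _.
by rewrite ler_nat fsubset_leq_card// sumsetS.
Qed.

Lemma sumset_bound1 (V : {fset G}) : V != fset0 -> sumset_bound u v 1 V.
Proof.
move=> V_neq0 A B; rewrite mul1r.
have [->|A_neq0] := eqVneq A fset0; first by rewrite cardfs0 gmean0l.
have [->|B_neq0] := eqVneq B fset0; first by rewrite cardfs0 gmean0r.
rewrite -[leRHS](gmeanxx uvD1)// ler_gmean// ler_nat.
  exact: leq_trans (card_sumset_ge A B_neq0) (card_sumset_ge _ V_neq0).
by rewrite (leq_trans (card_sumset_ge B A_neq0))// sumsetC card_sumset_ge.
Qed.

End SumsetBound.

Section SumsetBoundFibers.
Variables (R : realType) (G Q : zmodType) (f : {additive G -> Q}).

Lemma card_sumset_fibers_ge (u v C : R) (m : nat) (A B B' V : {fset G})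
    (y z : Q) :
  0 < u -> 0 < v -> u + v = 1 -> 0 <= C -> (0 < m)%N ->
  (forall x, (#|` fiber f A x| <= m)%N) ->
  B' `<=` B -> {in B', forall b, f b = y} -> {in V, forall w, f w = z} ->
  (forall x, C * gmean u v #|` fiber f A x|%:R #|` B'|%:R <=
    #|` sumset (sumset (fiber f A x) B') V|%:R) ->
  C * #|` A|%:R * (#|` B'|%:R / m%:R) `^ v <= #|` sumset (sumset A B) V|%:R.
Proof.
move=> u_gt0 v_gt0 uvD1 C_ge0 m_gt0 Am B'B fB' fV fiber_bound.
have m_gt0R : 0 < m%:R :> R by rewrite ltr0n.
have shift_uniq : uniq [seq x + (y + z) | x <- [fset f a | a in A]].
  by rewrite map_inj_uniq ?fset_uniq//; exact: addIr.
have := sum_card_fiber_le f (sumset (sumset A B) V) shift_uniq.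
rewrite big_map -(ler_nat R) natr_sum; apply: le_trans.
rewrite -(sum_card_fiber f A) natr_sum mulr_sumr mulr_suml.
apply: ler_sum => x _.
set a : R := _%:R; set b : R := #|` B'|%:R.
have ab_le : a * (b / m%:R) `^ v <= gmean u v a b.
  have -> : a * (b / m%:R) `^ v = gmean u v a (a * (b / m%:R)).
    rewrite -[X in gmean _ _ X _]mulr1 gmeanM// ?divr_ge0//.
    by rewrite gmeanxx// /gmean powR1 mul1r.
  apply: ler_gmean => //; first by rewrite mulr_ge0 ?divr_ge0.
  by rewrite mulrCA ler_piMr// ler_pdivrMr// mul1r ler_nat.
rewrite -mulrA; apply: le_trans (ler_wpM2l C_ge0 ab_le) _.
apply: le_trans (fiber_bound x) _; rewrite ler_nat fsubset_leq_card// addrA.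
by apply: sumset3_sub_fiber (@fiberP _ _ f A x) fB' fV; rewrite ?fiber_sub.
Qed.

(* The two lower bounds obtained by summing over the fibres of A against the
   largest fibre of B, and conversely, have weighted geometric mean free of
   the sizes of these fibres. *)
Lemma sumset_bound_of_fibers (u v C : R) (V : {fset G}) (z : Q) :
  0 < u -> 0 < v -> u + v = 1 -> 0 <= C -> {in V, forall w, f w = z} ->
  (forall A B x y, {in A, forall a, f a = x} -> {in B, forall b, f b = y} ->
    C * gmean u v #|` A|%:R #|` B|%:R <= #|` sumset (sumset A B) V|%:R) ->
  sumset_bound u v C V.
Proof.
move=> u_gt0 v_gt0 uvD1 C_ge0 fV fiber_bound A B.
have [->|A_neq0] := eqVneq A fset0; first by rewrite cardfs0 gmean0l// mulr0.
have [->|B_neq0] := eqVneq B fset0; first by rewrite cardfs0 gmean0r// mulr0.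
have [x Ax0 xP] := max_fiber f A_neq0; have [y By0 yP] := max_fiber f B_neq0.
set W : R := #|` sumset (sumset A B) V|%:R.
set r : R := #|` fiber f B y|%:R / #|` fiber f A x|%:R.
have r_gt0 : 0 < r by rewrite divr_gt0 ?ltr0n ?cardfs_gt0.
have boundA : C * #|` A|%:R * r `^ v <= W.
  apply: (card_sumset_fibers_ge u_gt0 v_gt0 uvD1 C_ge0 _ xP (fiber_sub f B y)
    (@fiberP _ _ f B y) fV) => [|w]; first by rewrite cardfs_gt0.
  by apply: fiber_bound; exact: fiberP.
have boundB : C * #|` B|%:R * r^-1 `^ u <= W.
  rewrite addrC in uvD1; rewrite invf_div /W (sumsetC A).
  apply: (card_sumset_fibers_ge v_gt0 u_gt0 uvD1 C_ge0 _ yP (fiber_sub f A x)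
    (@fiberP _ _ f A x) fV) => [|w]; first by rewrite cardfs_gt0.
  by rewrite gmeanC (sumsetC (fiber f B w)); apply: fiber_bound; exact: fiberP.
rewrite -[leRHS](gmeanxx uvD1)//.
have ratio_gmean : gmean u v (r `^ v) (r^-1 `^ u) = 1.
  rewrite /gmean -!powRrM [v * u]mulrC -powRM ?invr_ge0 ?ltW//.
  by rewrite mulfV ?powR1 ?gt_eqF.
apply: le_trans (ler_gmean u_gt0 v_gt0 _ _ boundA boundB).
- by rewrite gmeanM ?mulr_ge0 ?powR_ge0// ratio_gmean mulr1 gmeanZ.
- by rewrite !mulr_ge0 ?powR_ge0.
- by rewrite !mulr_ge0 ?powR_ge0.
Qed.

Variables (u v : R).
Hypotheses (u_gt0 : 0 < u) (v_gt0 : 0 < v) (uvD1 : u + v = 1).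

Lemma card_sumset_two_fibers_ge (t x0 y0 z : Q) (ia ib : G -> int)
    (A B V V' : {fset G}) (c c' : R) :
  injective (fun k : int => t *~ k) -> 0 < c' <= c ->
  {in A, forall a, f a = x0 + t *~ ia a} ->
  {in B, forall b, f b = y0 + t *~ ib b} ->
  {in V, forall w, f w = z} -> {in V', forall w, f w = z + t} ->
  sumset_bound u v c V -> sumset_bound u v c' V' ->
  quasicube_const u v * (c + c') * gmean u v #|` A|%:R #|` B|%:R <=
  #|` sumset (sumset A B) (V `|` V')|%:R.
Proof.
move=> t_inj c'c fA fB fV fV' bV bV'; set W := sumset _ (_ `|` _).
pose point k : Q := x0 + y0 + z + t *~ k.
pose X := [fset ia a | a in A]; pose Y := [fset ib b | b in B].
have point_inj : injective point by move=> k l /addrI /t_inj.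
have slice (C : R) (D : {fset G}) i j (k : int) :
    sumset_bound u v C D -> D `<=` V `|` V' ->
    {in D, forall w, f w = z + t *~ k} ->
    C * gmean u v #|` fiber ia A i|%:R #|` fiber ib B j|%:R <=
    #|` fiber f W (point (i + j + k))|%:R.
  move=> bD DV fD; apply: le_trans (bD _ _) _.
  rewrite ler_nat fsubset_leq_card//.
  have -> : point (i + j + k) = x0 + t *~ i + (y0 + t *~ j) + (z + t *~ k).
    by rewrite /point !mulrzDr (addrACA x0) (addrACA (x0 + y0)).
  apply: sumset3_sub_fiber fD; rewrite ?fiber_sub//.
    by move=> a; rewrite in_fiber => /andP[/fA -> /eqP ->].
  by move=> b; rewrite in_fiber => /andP[/fB -> /eqP ->].
rewrite -(sum_card_fiber ia A) -(sum_card_fiber ib B) !natr_sum.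
apply: (@le_trans _ _
  (\sum_(k <- two_point_sumset X Y) #|` fiber f W (point k)|%:R)).
  apply: two_point_prekopa_leindler => // i j _ _.
    rewrite -[i + j]addr0; apply: slice bV (fsubsetUl _ _) _ => w /fV ->.
    by rewrite mulr0z addr0.
  by apply: slice bV' (fsubsetUr _ _) _ => w /fV' ->; rewrite mulr1z.
rewrite -natr_sum ler_nat -(big_map point xpredT (fun q => #|` fiber f W q|)).
by rewrite sum_card_fiber_le// map_inj_uniq ?fset_uniq.
Qed.

End SumsetBoundFibers.

(** * Quasicubes *)

Lemma subgroup_quotient (G : zmodType) (H : G -> Prop) : is_subgroup H ->
  exists (Q : zmodType) (f : {additive G -> Q}), forall g, H g <-> f g = 0.
Proof.
case=> H0 HD HN; pose S : {pred G} := fun g => `[< H g >].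
have S_closed : zmod_closed S.
  split=> [|a b /asboolP Ha /asboolP Hb]; apply/asboolP => //.
  by apply: HD => //; exact: HN.
pose K := HB.pack_for (zmodClosed G) S (GRing.isZmodClosed.Build G S S_closed).
pose Q := Quotient.quot K; exists Q, \pi_Q%qT => g.
have KE : (g \in K) = (\pi_Q%qT g == 0).
  by rewrite -(raddf0 \pi_Q%qT) -Quotient.idealrBE subr0.
split=> [Hg|/eqP]; last by rewrite -KE => /asboolP.
by apply/eqP; rewrite -KE; apply/asboolP.
Qed.

Lemma is_subgroup_mulrz (Q : zmodType) (t : Q) :
  is_subgroup (fun q => exists k : int, q = t *~ k).
Proof.
split=> [|_ _ [k ->] [l ->]|_ [k ->]].
- by exists 0; rewrite mulr0z.
- by exists (k + l); rewrite mulrzDr.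
- by exists (- k); rewrite mulrNz.
Qed.

Definition infinite_order (Q : zmodType) (t : Q) : Prop :=
  forall n : nat, (0 < n)%N -> t *+ n <> 0.

Lemma infinite_orderN (Q : zmodType) (t : Q) :
  infinite_order t -> infinite_order (- t).
Proof.
move=> t_inf n n_gt0; rewrite mulNrn => /eqP.
by rewrite oppr_eq0 => /eqP; exact: t_inf.
Qed.

Lemma mulrz_injective (Q : zmodType) (t : Q) :
  infinite_order t -> injective (fun k : int => t *~ k).
Proof.
move=> t_inf k l tkl; have : t *~ (k - l) = 0 by rewrite mulrzBr tkl subrr.
case klE: (k - l) => [[|n]|n].
- by move=> _; apply/eqP; rewrite -subr_eq0 klE.
- by move=> /(t_inf n.+1 isT).
- by rewrite NegzE mulrNz => /eqP; rewrite oppr_eq0 => /eqP/(t_inf n.+1 isT).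
Qed.

Lemma mulrz_coordinates (T : choiceType) (Q P : zmodType) (f : T -> Q)
    (g : {additive Q -> P}) (t : Q) (A : {fset T}) (p : P) :
  (forall q, g q = 0 -> exists k : int, q = t *~ k) ->
  {in A, forall a, g (f a) = p} ->
  exists q (coord : T -> int), {in A, forall a, f a = q + t *~ coord a}.
Proof.
move=> kerP gA; have [->|/fset0Pn[a0 a0A]] := eqVneq A fset0.
  by exists 0, (fun=> 0) => a; rewrite inE.
suff /choice[coord coordP] : forall a, exists k, a \in A -> f a = f a0 + t *~ k.
  by exists (f a0), coord.
move=> a; have [aA|_] := boolP (a \in A); last by exists 0.
have /kerP[k fak] : g (f a - f a0) = 0 by rewrite raddfB !gA ?subrr.
by exists k; rewrite -fak subrKC.
Qed.

Section SumsetBoundTwoFibers.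
Variables (R : realType) (u v : R).
Hypotheses (u_gt0 : 0 < u) (v_gt0 : 0 < v) (uvD1 : u + v = 1).

(* Both A and B may be taken in a single coset of the preimage of Z(x - y). *)
Lemma sumset_bound_two_fibers (G Q : zmodType) (f : {additive G -> Q}) (x y : Q)
    (V V' : {fset G}) (c c' : R) :
  infinite_order (x - y) -> 0 <= c -> 0 <= c' ->
  {in V, forall w, f w = x} -> {in V', forall w, f w = y} ->
  sumset_bound u v c V -> sumset_bound u v c' V' ->
  sumset_bound u v (quasicube_const u v * (c + c')) (V `|` V').
Proof.
wlog c'c : x y V V' c c' / c' <= c.
  move=> wlog_le xy_inf c_ge0 c'_ge0 fV fV' bV bV'.
  have [c'c|/ltW cc'] := leP c' c; first exact: (wlog_le x y V V' c c').
  rewrite addrC fsetUC; apply: wlog_le fV' fV bV' bV => //.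
  by rewrite -opprB; exact: infinite_orderN.
move=> xy_inf c_ge0 + fV fV' bV bV'; rewrite le_eqVlt => /predU1P[c'0|c'_gt0].
  apply: sumset_bound_le (fsubsetUl _ _) bV.
  by rewrite -c'0 addr0 ler_piMl// quasicube_const_le1.
set t := y - x.
have t_inj : injective (fun k : int => t *~ k).
  by apply: mulrz_injective; rewrite /t -opprB; exact: infinite_orderN.
have [P [g gP]] := subgroup_quotient (is_subgroup_mulrz t).
have gt0 : g t = 0 by apply/gP; exists 1.
apply: (@sumset_bound_of_fibers _ _ _ (g \o f) u v _ _ (g x)) => //.
- by rewrite mulr_ge0 ?quasicube_const_ge0 ?addr_ge0 ?(ltW c'_gt0).
- move=> w /fsetUP[/fV /= ->//|/fV' /= ->].
  by rewrite -(subrK x y) raddfD gt0 add0r.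
move=> A B p q gA gB.
have [x0 [ia fA]] := mulrz_coordinates (fun r => (gP r).2) gA.
have [y0 [ib fB]] := mulrz_coordinates (fun r => (gP r).2) gB.
apply: (card_sumset_two_fibers_ge u_gt0 v_gt0 uvD1 t_inj _ fA fB fV _ bV bV').
  by rewrite c'_gt0.
by move=> w /fV' ->; rewrite /t addrC subrK.
Qed.

Lemma quasicube_sumset_bound (G : zmodType) (d : nat) (U : {fset G}) :
  quasicube d U -> forall V, V `<=` U ->
  sumset_bound u v (quasicube_const u v ^+ d * #|` V|%:R) V.
Proof.
have const_ge0 := quasicube_const_ge0 u v.
elim=> {d U} [g|d U Ux Uy H x y subH _ xy_notin U_cosets UxP UyP
  _ IHx _ IHy xy_inf] V VU.
  move: VU; rewrite fsubset1 expr0 mul1r => /orP[] /eqP ->.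
    by rewrite cardfs1; apply: sumset_bound1; rewrite // -cardfs_gt0 cardfs1.
  by move=> A B; rewrite cardfs0 mul0r.
have [Q [f fP]] := subgroup_quotient subH.
have cosetE g h : H (g - h) <-> f g = f h.
  rewrite fP raddfB; split=> [/eqP|->]; last exact: subrr.
  by rewrite subr_eq0 => /eqP.
pose Vx := V `&` Ux; pose Vy := V `&` Uy.
have fVx : {in Vx, forall w, f w = f x} by move=> w /fsetIP[_ /UxP[_ /cosetE]].
have fVy : {in Vy, forall w, f w = f y} by move=> w /fsetIP[_ /UyP[_ /cosetE]].
have VE : V = Vx `|` Vy.
  rewrite -fsetIUr; apply/esym/fsetIidPl/fsubsetP => w /(fsubsetP VU) wU.
  apply/fsetUP; case: (U_cosets _ wU) => Hw.
    by left; apply/UxP.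
  by right; apply/UyP.
have V_disjoint : Vx `&` Vy = fset0.
  apply/fsetP => w; rewrite [RHS]inE; apply/negP => /fsetIP[/fVx wx /fVy wy].
  by apply/xy_notin/cosetE; rewrite -wx.
have card_V : #|` V|%:R = #|` Vx|%:R + #|` Vy|%:R :> R.
  by rewrite VE -natrD -cardfsUI V_disjoint cardfs0 addn0.
rewrite exprS card_V -mulrA mulrDr VE.
apply: (@sumset_bound_two_fibers _ _ f (f x) (f y)) => //.
- by move=> n n_gt0; rewrite -raddfB -raddfMn => /fP; exact: xy_inf.
- by rewrite mulr_ge0 ?exprn_ge0.
- by rewrite mulr_ge0 ?exprn_ge0.
- by apply: IHx; exact: fsubsetIr.
- by apply: IHy; exact: fsubsetIr.
Qed.

End SumsetBoundTwoFibers.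

Lemma sumset_bound_beta_p (R : realType) (G : zmodType) (p C : R)
    (V : {fset G}) :
  sumset_bound p^-1 (1 - p^-1) C V -> C <= beta_p p V.
Proof.
move=> bV; apply: lb_le_inf => [|_ [A [B [A_neq0 B_neq0 ->]]]]; last first.
  by rewrite ler_pdivlMr ?bV// gmean_gt0 ?ltr0n ?cardfs_gt0.
eexists; exists [fset 0], [fset 0]; split; last reflexivity.
  by rewrite -cardfs_gt0 cardfs1.
by rewrite -cardfs_gt0 cardfs1.
Qed.

Unset Implicit Arguments.

Theorem mainTheorem2 (R : realType) (p : R) (G : zmodType) (d : nat)
    (U V : {fset G}) :
  1 < p -> quasicube d U -> V `<=` U ->
  let q := (1 - p^-1)^-1 in
  let c := (p `^ (p^-1) * q `^ (q^-1)) / 2 in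
  c <= 1 /\ c ^+ d * (#|` V|)%:R <= beta_p p V.
Proof.
move=> p_gt1 U_cube VU q c.
have p_gt0 : 0 < p by exact: lt_trans p_gt1.
have u_gt0 : 0 < p^-1 by rewrite invr_gt0.
have v_gt0 : 0 < 1 - p^-1 by rewrite subr_gt0 invf_lt1.
have uvD1 : p^-1 + (1 - p^-1) = 1 by rewrite addrC subrK.
have -> : c = quasicube_const p^-1 (1 - p^-1).
  by rewrite /c /q /quasicube_const /gmean !invrK.
split; first exact: quasicube_const_le1.
apply: sumset_bound_beta_p.
exact: (quasicube_sumset_bound u_gt0 v_gt0 uvD1 U_cube VU).
Qed.
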